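(* Let $X$ be a real separable Hilbert space, $U:=[-\tfrac12,\tfrac12]^{\mathbb N}$, let $\mu$ be a probability measure on $[-\tfrac12,\tfrac12]$ and $\boldsymbol\mu(\mathrm d\boldsymbol y):=\bigotimes_{j\ge1}\mu(\mathrm dy_j)$ the corresponding countable product probability measure on $U$. Let $p\in(0,1)$ and $k:=\lceil\frac1{1-p}\rceil$. Let $g\colon U\to X$, and for $s\in\mathbb N$ put $g_s(\boldsymbol y):=g(y_1,\ldots,y_s,0,0,\ldots)$. Suppose that: (1) for $\boldsymbol\mu$-a.e. $\boldsymbol y\in U$, $\|g(\boldsymbol y)-g_s(\boldsymbol y)\|_X\to0$ as $s\to\infty$; (2) there are a sequence $(\Theta_\ell)_{\ell\ge0}$ of nonnegative numbers and a sequence $\boldsymbol b=(b_j)_{j\ge1}$ of nonnegative numbers with $\boldsymbol b\in\ell^p(\mathbb N)$ and $b_1\ge b_2\ge\cdots$, such that $g$ is continuously differentiable up to order $k+1$ with $$\|\partial^{\boldsymbol\nu}g(\boldsymbol y)\|_X\le\Theta_{|\boldsymbol\nu|}\,\boldsymbol b^{\boldsymbol\nu}\quad\text{for all }\boldsymbol y\in U\text{ and all }\boldsymbol\nu\in\mathbb N_0^{\mathbb N}\text{ with }|\boldsymbol\nu|\le k+1;$$ (3) $\int_{-1/2}^{1/2}y\,\mu(\mathrm dy)=0$, and there is a constant $C_\mu\ge0$ such that $\int_{-1/2}^{1/2}|y|^m\,\mu(\mathrm dy)\le C_\mu$ for all integers $m\ge2$. Let $\boldsymbol\xi\colon U\to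 U$ be a map of the form $\boldsymbol\xi(\boldsymbol y):=(\xi(y_1),\xi(y_2),\ldots)$ with $\xi\colon[-\tfrac12,\tfrac12]\to[-\tfrac12,\tfrac12]$ such that: (4) $\xi(0)=0$ and $\int_{-1/2}^{1/2}\xi(y)\,\mu(\mathrm dy)=0$; (5) there is a constant $C_\xi\ge0$ such that $\int_{-1/2}^{1/2}|\xi(y)|^m\,\mu(\mathrm dy)\le C_\xi$ for all integers $m\ge2$. Define $g_{\boldsymbol\xi}(\boldsymbol y):=g(\boldsymbol\xi(\boldsymbol y))$ and $g_{\boldsymbol\xi,s}(\boldsymbol y):=g_{\boldsymbol\xi}(y_1,\ldots,y_s,0,0,\ldots)$ for $\boldsymbol y\in U$. Then $$\|g_{\boldsymbol\xi}-g_{\boldsymbol\xi,s}\|_{L^2_{\boldsymbol\mu}(U;X)}=\mathcal O\big(s^{-\frac1p+\frac12}\big),$$ where the implied coefficient is independent of $s$; that is, there is a constant $C>0$ independent of $s$ such that $\|g_{\boldsymbol\xi}-g_{\boldsymbol\xi,s}\|_{L^2_{\boldsymbol\mu}(U;X)}\le C\,s^{-\frac1p+\frac12}$ for all $s\ge1$.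
   Context: For a multi-index $\boldsymbol\nu=(\nu_j)_{j\ge1}\in\mathbb N_0^{\mathbb N}$, $|\boldsymbol\nu|:=\sum_{j\ge1}\nu_j$ (so $|\boldsymbol\nu|<\infty$ means finitely supported). For a real sequence $\boldsymbol x=(x_j)_{j\ge1}$ and finitely supported $\boldsymbol\nu$, $\boldsymbol x^{\boldsymbol\nu}:=\prod_{j\ge1}x_j^{\nu_j}$ with the convention $0^0:=1$. $\partial^{\boldsymbol\nu}$ denotes the mixed partial derivative of order $\nu_j$ in each variable $y_j$. $L^2_{\boldsymbol\mu}(U;X)$ is the Hilbert space of equivalence classes (under $\boldsymbol\mu$-a.e. equality) of strongly $\boldsymbol\mu$-measurable functions $f\colon U\to X$ with $\|f\|_{L^2_{\boldsymbol\mu}(U;X)}:=\big(\int_U\|f(\boldsymbol y)\|_X^2\,\boldsymbol\mu(\mathrm d\boldsymbol y)\big)^{1/2}<\infty$. *)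

(* Defs.v *)
From HB Require Import structures.
From mathcomp Require Import all_boot all_order all_algebra sesquilinear.
From mathcomp Require Import finmap.
From mathcomp Require Import all_classical all_reals all_analysis.

Set Implicit Arguments.
Unset Strict Implicit.
Unset Printing Implicit Defensive.
Import Order.TTheory GRing.Theory Num.Theory.
Import numFieldNormedType.Exports.

Local Open Scope classical_set_scope.
Local Open Scope ring_scope.

(** [hitv R] is [-1/2, 1/2] as a type, with the subspace topology and the trace
    of the Borel sigma-algebra; [cube R] is U = [-1/2, 1/2]^N with the product
    topology and the product sigma-algebra.  Coordinates are numbered from 0:
    the variable y_j, j >= 1, is [y j.-1]. *)

Definition half_interval (R : realType) : set R := [set` `[- 2^-1, 2^-1]].
Arguments half_interval : clear implicits.

Definition hitv (R : realType) : Type := set_type (half_interval R).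

Definition hitv_val (R : realType) (x : hitv R) : R := set_val x.

Lemma hitv_mem0 (R : realType) : (0 : R) \in half_interval R.
Proof.
by rewrite inE /half_interval /= in_itv /= oppr_le0 invr_ge0 ler0n.
Qed.

Definition hitv0 (R : realType) : hitv R := exist _ 0 (hitv_mem0 R).
Arguments hitv0 : clear implicits.

HB.instance Definition _ (R : realType) :=
  Choice.copy (hitv R) (set_type (half_interval R)).
HB.instance Definition _ (R : realType) :=
  PseudoMetric.copy (hitv R) (set_type (half_interval R)).
HB.instance Definition _ (R : realType) := isPointed.Build (hitv R) (hitv0 R).

Definition hitv_measurable (R : realType) : set (set (hitv R)) :=
  preimage_set_system setT (@hitv_val R) measurable.

Arguments hitv_measurable : clear implicits.

Lemma hitv_sigma_algebra (R : realType) : sigma_algebra setT (hitv_measurable R).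
Proof. exact/sigma_algebra_preimage/sigma_algebra_measurable. Qed.

Lemma hitv_measurable0 (R : realType) : hitv_measurable R set0.
Proof. by have [] := hitv_sigma_algebra R. Qed.

Lemma hitv_measurableC (R : realType) (A : set (hitv R)) :
  hitv_measurable R A -> hitv_measurable R (~` A).
Proof. by have [_ + _] := hitv_sigma_algebra R => /[apply]; rewrite setTD. Qed.

Lemma hitv_measurableU (R : realType) (F : (set (hitv R))^nat) :
  (forall i, hitv_measurable R (F i)) -> hitv_measurable R (\bigcup_i F i).
Proof. by have [_ _] := hitv_sigma_algebra R; apply. Qed.

HB.instance Definition _ (R : realType) :=
  @isMeasurable.Build default_measure_display (hitv R) (hitv_measurable R)
    (@hitv_measurable0 R) (@hitv_measurableC R) (@hitv_measurableU R).

Definition cube (R : realType) : Type := nat -> hitv R.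

HB.instance Definition _ (R : realType) := Choice.copy (cube R) (nat -> hitv R).
HB.instance Definition _ (R : realType) :=
  Topological.copy (cube R) (prod_topology (fun _ : nat => hitv R)).
HB.instance Definition _ (R : realType) :=
  isPointed.Build (cube R) (fun=> hitv0 R).

Definition cube_measurable (R : realType) : set (set (cube R)) :=
  <<s \bigcup_(j in [set: nat])
        preimage_set_system setT (fun y : cube R => y j) measurable >>.

Arguments cube_measurable : clear implicits.

Lemma cube_measurable0 (R : realType) : cube_measurable R set0.
Proof. exact: sigma_algebra0. Qed.

Lemma cube_measurableC (R : realType) (A : set (cube R)) :
  cube_measurable R A -> cube_measurable R (~` A).
Proof. exact: sigma_algebraC. Qed.

Lemma cube_measurableU (R : realType) (F : (set (cube R))^nat) :
  (forall i, cube_measurable R (F i)) -> cube_measurable R (\bigcup_i F i).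
Proof. exact: sigma_algebra_bigcup. Qed.

HB.instance Definition _ (R : realType) :=
  @isMeasurable.Build default_measure_display (cube R) (cube_measurable R)
    (@cube_measurable0 R) (@cube_measurableC R) (@cube_measurableU R).

(** [P] is the countable product of copies of [mu]: by the pi-lambda theorem,
    the values on finite-dimensional measurable rectangles determine the
    probability measure [P]. *)
Definition is_product_measure (R : realType)
    (mu : probability (hitv R) R) (P : probability (cube R) R) : Prop :=
  forall (n : nat) (A : nat -> set (hitv R)),
    (forall j, measurable (A j)) ->
    P [set y | forall j, (j < n)%N -> A j (y j)] = (\prod_(j < n) mu (A j))%E.

Definition cube_trunc (R : realType) (s : nat) (y : cube R) : cube R :=
  fun j => if (j < s)%N then y j else hitv0 R.

Definition cube_map (R : realType) (xi : hitv R -> hitv R) (y : cube R) : cube R :=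
  fun j => xi (y j).

Definition is_hilbert (R : realType) (X : completeNormedModType R) : Prop :=
  exists ip : {dot X for idfun}, forall x : X, `|x| ^+ 2 = ip x x.

Definition separable (T : topologicalType) : Prop :=
  exists2 D : set T, countable D & dense D.

Definition strongly_measurable d (T : measurableType d) (R : realType)
    (X : normedModType R) (P : {measure set T -> \bar R}) (f : T -> X) : Prop :=
  exists f_ : nat -> T -> X,
    [/\ forall n, finite_set (range (f_ n)),
        forall n x, measurable (f_ n @^-1` [set x]) &
        {ae P, forall y, f_ n y @[n --> \oo] --> f y}].

Definition L2norm d (T : measurableType d) (R : realType)
    (X : normedModType R) (P : {measure set T -> \bar R}) (f : T -> X) : \bar R :=
  Lnorm P 2%:E (fun y => `|f y|%:E).

(** The limit is taken in [hitv R], hence is one-sided when y j = -1/2 or 1/2. *)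
Definition partial_quotient (R : realType) (X : normedModType R) (j : nat)
    (f : cube R -> X) (y : cube R) (t : hitv R) : X :=
  (hitv_val t - hitv_val (y j))^-1 *: (f (dfwith y j t) - f y).

Definition partial (R : realType) (X : normedModType R) (j : nat)
    (f : cube R -> X) (y : cube R) : X :=
  lim (partial_quotient j f y t @[t --> (y j)^']).

Definition partially_derivable (R : realType) (X : normedModType R) (j : nat)
    (f : cube R -> X) : Prop :=
  forall y : cube R, cvg (partial_quotient j f y t @[t --> (y j)^']).

(** All iterated partial derivatives of order at most [n], including [f] itself
    and in every order of differentiation, exist and are continuous for the
    product topology on [cube R]. *)
Fixpoint contdiff (R : realType) (X : normedModType R) (n : nat)
    (f : cube R -> X) : Prop :=
  continuous f /\
  (if n is n'.+1 then
     forall j, partially_derivable j f /\ contdiff n' (partial j f)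
   else True).

Definition multi_index : Type := {fsfun nat -> nat with 0%N}.

Definition mi_abs (nu : multi_index) : nat := (\sum_(j <- finsupp nu) nu j)%N.

Definition mi_pow (R : realType) (b : nat -> R) (nu : multi_index) : R :=
  \prod_(j <- finsupp nu) b j ^+ nu j.

(** The differentiations are carried out in a fixed order; for the functions in
    [contdiff n] with |nu| <= n the order does not matter. *)
Definition mixed_partial (R : realType) (X : normedModType R)
    (nu : multi_index) (f : cube R -> X) : cube R -> X :=
  foldr (fun j h => iter (nu j) (partial j) h) f
        (sort leq (finsupp nu : seq nat)).

(* Main.v *)
(** Put eta_j = xi(y_j), which are independent and centred.  Adding one coordinate
    at a time gives
      g(eta_{<n}) - g(eta_{<s}) = M + r,
      M = sum_{s <= j < n} eta_j (d_j g)(eta_{<j}),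
    where |r| <= sum_j Theta_2 b_j^2 by Taylor's formula in the single variable
    y_j.  The summands of M are martingale differences, hence orthogonal in L^2,
    and E|M|^2 <= Theta_1^2 sum_j b_j^2.  Since b is nonincreasing and in l^p,
    sum_{j >= s} b_j^2 <= b_s^(2-p) |b|_p^p = O(s^(1-2/p)), and n -> oo is Fatou's
    lemma together with the continuity of g for the product topology. *)

Require Import Defs.
From HB Require Import structures.
From mathcomp Require Import all_boot all_order all_algebra sesquilinear.
From mathcomp Require Import finmap.
From mathcomp Require Import all_classical all_reals all_analysis.
From mathcomp Require Import measurable_realfun ring lra.
Import Order.TTheory GRing.Theory Num.Theory.
Import numFieldNormedType.Exports.
Local Open Scope classical_set_scope.
Local Open Scope ring_scope.
Set Implicit Arguments.
Unset Strict Implicit.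
Unset Printing Implicit Defensive.

(** * Real inner products on a Hilbert space *)

Definition inner_product (R : realType) (X : completeNormedModType R)
    (ip : X -> X -> R) : Prop :=
  [/\ forall x, `|x| ^+ 2 = ip x x, forall x y, ip x y = ip y x,
      forall x y z, ip x (y + z) = ip x y + ip x z
    & forall a x y, ip x (a *: y) = a * ip x y].

Lemma hilbert_inner_product (R : realType) (X : completeNormedModType R) :
  is_hilbert X -> exists ip : X -> X -> R, inner_product ip.
Proof.
case=> ip ipE; exists ip; split=> // [x y|x y z|a x y].
- by rewrite (hermC ip) expr0 mul1r.
- exact: (linearDr ip).
- exact: (linearZr_LR ip).
Qed.

Section inner_product_theory.
Context (R : realType) (X : completeNormedModType R) (ip : X -> X -> R).
Hypothesis ipP : inner_product ip.

Lemma ipE x : `|x| ^+ 2 = ip x x. Proof. by case: ipP. Qed.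
Lemma ipC x y : ip x y = ip y x. Proof. by case: ipP. Qed.
Lemma ipDr x y z : ip x (y + z) = ip x y + ip x z.
Proof. by case: ipP. Qed.
Lemma ipZr a x y : ip x (a *: y) = a * ip x y. Proof. by case: ipP. Qed.
Lemma ipBr x y z : ip x (y - z) = ip x y - ip x z.
Proof. by rewrite ipDr -scaleN1r ipZr mulN1r. Qed.

Lemma sqr_normD x y : `|x + y| ^+ 2 = `|x| ^+ 2 + 2 * ip x y + `|y| ^+ 2.
Proof. by rewrite !ipE ipDr ![ip (x + y) _]ipC !ipDr (ipC y x); ring. Qed.

Lemma ip_polarization x y : ip x y = (`|x + y| ^+ 2 - `|x - y| ^+ 2) / 4.
Proof.
rewrite sqr_normD sqr_normD normrN -(scaleN1r y) ipZr.
by field.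
Qed.

(** Polarization expresses [ip] through the norm, whose continuity is known. *)
Lemma ip_continuous (T : topologicalType) (u v : T -> X) :
  continuous u -> continuous v -> continuous (fun t => ip (u t) (v t)).
Proof.
move=> cu cv t.
rewrite (_ : (fun _ => _) = fun t => (`|u t + v t| * `|u t + v t| -
   `|u t - v t| * `|u t - v t|) * 4^-1); last first.
  by apply/funext => z; rewrite ip_polarization !expr2.
apply: cvgM; last exact: cvg_cst.
have cD : `|u z + v z| @[z --> t] --> `|u t + v t|.
  by apply: cvg_norm; apply: cvgD; [exact: cu|exact: cv].
have cB : `|u z - v z| @[z --> t] --> `|u t - v t|.
  by apply: cvg_norm; apply: cvgB; [exact: cu|exact: cv].
by apply: cvgB; exact: cvgM.
Qed.

Lemma ip_cvgr v (T : Type) (F : set_system T) (FF : Filter F) (f : T -> X) l :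
  f @ F --> l -> ip v (f x) @[x --> F] --> ip v l.
Proof.
move=> fl; apply: continuous_cvg => //.
apply: (@ip_continuous _ (fun=> v) id); first exact: cst_continuous.
by move=> x; exact: cvg_id.
Qed.

(* Expand [0 <= |x - (<x, y> / |y|^2) y|^2]. *)
Lemma ip_le x y : ip x y <= `|x| * `|y|.
Proof.
have [->|y0] := eqVneq y 0.
  by rewrite -(scale0r 0) ipZr mul0r normrZ normr0 mul0r mulr0.
have ny : 0 < `|y| by rewrite normr_gt0.
have [xy|xy] := leP (ip x y) 0; first by rewrite (le_trans xy)// mulr_ge0.
have xy0 := ltW xy; rewrite -(@ler_pXn2r _ 2)// ?nnegrE ?mulr_ge0// exprMn.
have := sqr_ge0 `|x - (ip x y / `|y| ^+ 2) *: y|.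
rewrite sqr_normD normrN normrZ -scaleNr ipZr exprMn real_normK ?num_real//.
set c := ip x y; set n := `|y|.
have n0 : n != 0 by rewrite gt_eqF.
rewrite (_ : _ + _ + _ = (`|x| ^+ 2 * n ^+ 2 - c ^+ 2) / n ^+ 2); last by field.
by rewrite pmulr_lge0 ?invr_gt0 ?exprn_gt0// subr_ge0.
Qed.

Lemma ip_abs_le x y : `|ip x y| <= `|x| * `|y|.
Proof.
rewrite ler_norml ip_le andbT lerNl -mulN1r -ipZr scaleN1r.
by rewrite (le_trans (ip_le _ _))// normrN.
Qed.

End inner_product_theory.

(** * The cube and its one-variable sections *)

Section cube_topology.
Context (R : realType).

Lemma hitv_valP (t : hitv R) : - 2^-1 <= hitv_val t <= 2^-1.
Proof. by have := set_valP t; rewrite /half_interval /= in_itv. Qed.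

Lemma hitv_val_inj : injective (@hitv_val R).
Proof. exact: val_inj. Qed.

Lemma hitv_norm_le1 (t : hitv R) : `|hitv_val t| <= 1.
Proof. by have /andP[? ?] := hitv_valP t; rewrite ler_norml; lra. Qed.

Lemma hitv_val_continuous : continuous (@hitv_val R).
Proof. exact: (@initial_continuous _ _ (@hitv_val R)). Qed.

Lemma hitv_cvg (T : Type) (F : set_system T) (FF : Filter F) (u : T -> hitv R)
    (x : hitv R) :
  hitv_val (u t) @[t --> F] --> hitv_val x -> u @ F --> x.
Proof.
move=> ux; apply/cvg_ballP => e e0.
by move/cvg_ballP : ux => /(_ e e0).
Qed.

Lemma cube_cvg (T : Type) (F : set_system T) (FF : Filter F) (u : T -> cube R)
    (y : cube R) :
  (forall j, u t j @[t --> F] --> y j) -> u @ F --> y.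
Proof.
move=> uy; apply/cvg_sup => i A [_ [[C oC <-] By sBA]].
have : nbhs (y i : hitv R) C by exact: (open_nbhs_nbhs (conj oC By)).
by move/(uy i) => FC; apply: (@filterS _ F FF _ _ _ FC) => t Ct; exact: sBA.
Qed.

Lemma cube_proj_continuous j : continuous (fun y : cube R => y j).
Proof. exact: (@proj_continuous _ (fun _ : nat => hitv R) j). Qed.

Lemma cube_trunc_continuous s : continuous (@cube_trunc R s).
Proof.
move=> y; apply: (@cube_cvg _ _ (nbhs_filter y)) => j; rewrite /cube_trunc.
by case: ifP => _; [exact: cube_proj_continuous|exact: cvg_cst].
Qed.

Lemma cube_trunc_cvg (y : cube R) : cube_trunc s y @[s --> \oo] --> y.
Proof.
apply: cube_cvg => j; apply: cvg_near_cst; exists j.+1 => // s /= js.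
by rewrite /cube_trunc js.
Qed.

Lemma dfwith_cube_continuous (y : cube R) j :
  continuous (fun t => dfwith y j t : cube R).
Proof.
move=> t; apply: (@cube_cvg _ _ (nbhs_filter t)) => i; have [<-|ji] := eqVneq j i.
  rewrite (_ : (fun _ => _) = id); last by apply/funext => x; rewrite dfwithin.
  by rewrite dfwithin; exact: cvg_id.
rewrite (_ : (fun _ => _) = cst (y i)).
  by rewrite dfwithout//; exact: cvg_cst.
by apply/funext => x; rewrite dfwithout.
Qed.

Lemma dfwith_dfwith (y : cube R) j t u :
  dfwith (dfwith y j t) j u = dfwith y j u.
Proof.
apply/funext => i; have [<-|ji] := eqVneq j i; first by rewrite !dfwithin.
by rewrite !dfwithout.
Qed.

(** Consecutive truncations differ in one coordinate only, so the increment of a function between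
    them is a one-variable increment starting at the value [0], as in [coordinate_taylor]. *)
Lemma cube_truncS s (y : cube R) :
  cube_trunc s.+1 y = dfwith (cube_trunc s y) s (y s).
Proof.
apply/funext => i; have [<-|ji] := eqVneq s i.
  by rewrite dfwithin /cube_trunc ltnSn.
by rewrite dfwithout// /cube_trunc ltnS leq_eqVlt eq_sym (negbTE ji).
Qed.

Lemma dfwith_trunc0 s (y : cube R) :
  dfwith (cube_trunc s y) s (hitv0 R) = cube_trunc s y.
Proof.
apply/funext => i; have [<-|ji] := eqVneq s i; last by rewrite dfwithout.
by rewrite dfwithin /cube_trunc ltnn.
Qed.

Lemma cube_trunc_trunc m n (y : cube R) : (m <= n)%N ->
  cube_trunc m (cube_trunc n y) = cube_trunc m y.
Proof.
move=> mn; apply/funext => j; rewrite /cube_trunc; case: ifP => // jm.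
by rewrite (leq_trans jm mn).
Qed.

(** A coordinate replaced by [0] stays [0] under [xi]. Hence the truncated function in the theorem
    is [g] at a truncation of [cube_map xi y], and the past of [cube_map xi y] depends only on the
    past of [y]. *)
Lemma cube_map_trunc (xi : hitv R -> hitv R) s (y : cube R) :
  xi (hitv0 R) = hitv0 R ->
  cube_map xi (cube_trunc s y) = cube_trunc s (cube_map xi y).
Proof.
by move=> xi0; apply/funext => j; rewrite /cube_map /cube_trunc; case: ifP.
Qed.

(** Retraction of the line onto [-1/2, 1/2]. Through it a section of a function on the cube is
    defined on all of [R], where derivatives and the mean value theorem are available. *)
Definition clamp_val (x : R) : R := Num.max (- 2^-1) (Num.min x 2^-1).

Lemma clamp_mem (x : R) : clamp_val x \in half_interval R.
Proof.
rewrite inE /half_interval /= in_itv /= /clamp_val le_max lexx /=.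
by rewrite ge_max ge_min lexx orbT andbT; lra.
Qed.

Definition clamp (x : R) : hitv R := exist _ (clamp_val x) (clamp_mem x).

Lemma clamp_valE (x : R) : `|x| <= 2^-1 -> hitv_val (clamp x) = x.
Proof.
rewrite ler_norml => /andP[x1 x2].
change (clamp_val x = x); by rewrite /clamp_val (min_idPl x2) (max_idPr x1).
Qed.

Lemma clampK (t : hitv R) : clamp (hitv_val t) = t.
Proof. by apply: hitv_val_inj; rewrite clamp_valE// ler_norml hitv_valP. Qed.

Lemma clamp0 : clamp 0 = hitv0 R.
Proof. by apply: hitv_val_inj; rewrite clamp_valE// normr0 invr_ge0. Qed.

(** Once [max] and [min] are written with absolute values, only sums, halves and norms remain. *)
Lemma clamp_val_continuous : continuous clamp_val.
Proof.
rewrite (_ : clamp_val = fun z => (- 2^-1 + (z + 2^-1 - `|z - 2^-1|) / 2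
  + `|- 2^-1 - (z + 2^-1 - `|z - 2^-1|) / 2|) / 2); last first.
  by apply/funext => z; rewrite /clamp_val maxr_absE minr_absE.
have cid : continuous (fun z : R => z) by move=> x; exact: cvg_id.
have cc (a : R) : continuous (fun _ : R => a) by exact: cst_continuous.
have cabs (f : R -> R) : continuous f -> continuous (fun z => `|f z|).
  by move=> cf x; apply: cvg_norm; exact: cf.
have cD (f h : R -> R) : continuous f -> continuous h ->
    continuous (fun z => f z + h z).
  by move=> cf ch x; apply: cvgD; [exact: cf|exact: ch].
have cB (f h : R -> R) : continuous f -> continuous h ->
    continuous (fun z => f z - h z).
  by move=> cf ch x; apply: cvgB; [exact: cf|exact: ch].
have cM (f : R -> R) : continuous f -> continuous (fun z => f z / 2).
  by move=> cf x; apply: cvgM; [exact: cf|exact: cvg_cst].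
have cmin : continuous (fun z : R => (z + 2^-1 - `|z - 2^-1|) / 2).
  by apply: (cM); apply: (cB); [exact: cD|apply: (cabs); exact: cB].
by apply: cM; apply: (cD); [exact: cD|apply: cabs; exact: cB].
Qed.

Lemma clamp_continuous : continuous clamp.
Proof.
by move=> x; apply: (@hitv_cvg _ _ (nbhs_filter x)); exact: clamp_val_continuous.
Qed.

End cube_topology.

(** The mean value theorem from [0], for either sign of [x]. Differentiability is asked for only in
    the open ball, because functions extended by [clamp] may have corners at the end points. *)
Lemma MVT0 (R : realType) (f df : R -> R) (r x : R) : 0 < r ->
  (forall y : R, `|y| < r -> is_derive y (1 : R) f (df y)) -> continuous f ->
  `|x| <= r -> exists2 c, `|c| < r & f x - f 0 = df c * x.
Proof.
move=> r0 fdf cf; rewrite ler_norml => /andP[rx xr].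
have [x0|x0|->] := ltgtP x 0.
- have [||c] := @MVT R f df x 0 x0.
  + move=> y; rewrite in_itv /= => /andP[xy y0].
    by apply: fdf; rewrite ltr_norml; lra.
  + exact: continuous_subspaceT.
  rewrite in_itv /= => /andP[xc c0] E; exists c; first by rewrite ltr_norml; lra.
  by move: E; rewrite sub0r mulrN => /(congr1 -%R); rewrite opprB opprK.
- have [||c] := @MVT R f df 0 x x0.
  + move=> y; rewrite in_itv /= => /andP[xy y0].
    by apply: fdf; rewrite ltr_norml; lra.
  + exact: continuous_subspaceT.
  rewrite in_itv /= => /andP[xc c0] E; exists c; first by rewrite ltr_norml; lra.
  by rewrite E subr0.
- by exists 0; rewrite ?normr0// subrr mulr0.
Qed.

(** * Second-order Taylor estimate in one coordinate *)

Section coordinate_taylor.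
Context (R : realType) (X : completeNormedModType R) (ip : X -> X -> R).
Hypothesis ipP : inner_product ip.

(** Pairing with [v] gives a real-valued function. Its difference quotients over [R] are those of
    [partial_quotient] pulled back along h -> clamp (h + x), since [clamp] is the identity near the
    interior point [x]. *)
Lemma is_derive_coordinate (f : cube R -> X) j (z : cube R) (v : X) (x : R) :
  partially_derivable j f -> `|x| < 2^-1 ->
  is_derive x (1 : R) (fun t => ip v (f (dfwith z j (clamp t))))
    (ip v (partial j f (dfwith z j (clamp x)))).
Proof.
move=> df xh; set y := dfwith z j (clamp x).
have yj : y j = clamp x by rewrite /y dfwithin.
have clx : hitv_val (clamp x) = x by rewrite clamp_valE// ltW.
have near0 : \forall h \near (0 : R), `|h + x| <= 2^-1.
  exists (2^-1 - `|x|) => /=; first by rewrite subr_gt0.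
  move=> h /=; rewrite sub0r normrN => hx.
  by rewrite (le_trans (ler_normD _ _))// -lerBrDr ltW.
(* The partial derivative is a limit over a punctured filter, so [clamp (h + x)] must also avoid
   [clamp x]. It does for small nonzero [h], where its value is [h + x]. *)
have cl : clamp (h + x) @[h --> 0^'] --> (y j)^'.
  rewrite yj => A; rewrite /= !nbhs_filterE /dnbhs /within /= => nA.
  have : clamp (h + x) @[h --> (0 : R)] --> clamp (0 + x).
    apply: continuous_cvg; first exact: clamp_continuous.
    by apply: cvgD; [exact: cvg_id|exact: cvg_cst].
  rewrite add0r => /(_ _ nA); rewrite /= nbhs_filterE => nA'.
  near=> h => h0; have : clamp (h + x) != clamp x -> A (clamp (h + x)).
    by near: h.
  apply; apply/eqP => /(congr1 (@hitv_val R)); rewrite clx clamp_valE.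
    by move=> E; case/eqP: h0; rewrite -(addrK x h) E subrr.
  by near: h.
have dl : partial_quotient j f y t @[t --> (y j)^'] --> partial j f y := df y.
have cq : h^-1 *: (ip v (f (dfwith z j (clamp (h *: (1 : R) + x)))) - ip v (f y))
    @[h --> 0^'] --> ip v (partial j f y).
  have cq : ip v (partial_quotient j f y (clamp (h + x))) @[h --> 0^'] -->
      ip v (partial j f y).
    by apply: (ip_cvgr ipP); exact: (cvg_comp _ _ cl dl).
  have eqn : \forall h \near (0 : R)^', ip v (partial_quotient j f y (clamp (h + x)))
      = h^-1 *: (ip v (f (dfwith z j (clamp (h *: (1 : R) + x)))) - ip v (f y)).
    apply: nbhs_dnbhs; apply: filterS near0 => h hx.
    rewrite /partial_quotient /= yj clx clamp_valE// addrK (ipZr ipP).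
    by rewrite (ipBr ipP) dfwith_dfwith [h *: 1]mulr1.
  by apply: cvg_trans cq; exact: near_eq_cvg.
apply: DeriveDef; first by apply/cvg_ex; exists (ip v (partial j f y)).
by apply: cvg_lim => //; exact: norm_hausdorff.
Unshelve. all: by end_near. Qed.

Lemma coordinate_path_continuous (f : cube R -> X) j (z : cube R) (v : X) :
  continuous f -> continuous (fun t => ip v (f (dfwith z j (clamp t)))).
Proof.
move=> cf; have cfz : continuous (fun t => f (dfwith z j (clamp t))).
  move=> t; have c1 := @clamp_continuous R t.
  have c2 := @dfwith_cube_continuous R z j (clamp t).
  have c3 := cf (dfwith z j (clamp t)).
  exact: (cvg_comp _ _ (cvg_comp _ _ c1 c2) c3).
exact: (ip_continuous ipP (@cst_continuous _ _ v) cfz).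
Qed.

(* Testing against the remainder [w] itself reduces the vector-valued estimate
   to two applications of the scalar mean value theorem. *)
Lemma coordinate_taylor (f : cube R -> X) j (K : R) (z : cube R) (t : hitv R) :
  contdiff 2 f -> (forall y, `|partial j (partial j f) y| <= K) ->
  `|f (dfwith z j t) - f (dfwith z j (hitv0 R))
    - hitv_val t *: partial j f (dfwith z j (hitv0 R))| <= K.
Proof.
move=> [cf /(_ j)[df [cdf /(_ j)[ddf _]]]] fK.
set D := partial j f (dfwith z j (hitv0 R)); set w := (X in `|X|).
have h0 : 0 < 2^-1 :> R by rewrite invr_gt0.
have th : `|hitv_val t| <= 2^-1 by rewrite ler_norml hitv_valP.
(* The increment of [psi] from [0] to [hitv_val t] is <w, w>, and [dpsi] is the derivative of [psi]
   inside the interval. Since [dpsi 0 = 0], a second mean value theorem turns [dpsi c] into a second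
   derivative times [c]. *)
pose psi x := ip w (f (dfwith z j (clamp x))) - x * ip w D.
pose dpsi x := ip w (partial j f (dfwith z j (clamp x))) - ip w D.
have [c ch E] : exists2 c, `|c| < 2^-1 &
    psi (hitv_val t) - psi 0 = dpsi c * hitv_val t.
  apply: MVT0 => //.
    move=> y yh; rewrite /psi /dpsi.
    have d1 := is_derive_coordinate z w df yh.
    have d2 : is_derive y (1 : R) (fun x => x * ip w D) (ip w D).
      rewrite (_ : (fun x => _) = (ip w D) \*: id); last first.
        by apply/funext => x /=; rewrite mulrC.
      by apply: is_derive_eq; rewrite [LHS]mulr1.
    exact: is_deriveB.
  move=> x; apply: cvgB; first exact: coordinate_path_continuous.
  by apply: cvgM; [exact: cvg_id|exact: cvg_cst].
have [c' _ E'] := MVT0 h0 (fun y => is_derive_coordinate z w ddf (x := y))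
   (@coordinate_path_continuous _ j z w cdf) (ltW ch).
have Ew : `|w| ^+ 2 = ip w (partial j (partial j f) (dfwith z j (clamp c')))
    * c * hitv_val t.
  rewrite -E' clamp0 -/D -/(dpsi c) -E /psi clamp0 clampK mul0r subr0.
  by rewrite (ipE ipP) {2}/w !(ipBr ipP) (ipZr ipP) addrAC.
have K0 : 0 <= K by apply: le_trans (fK z).
(* The factors [c] and [hitv_val t] have absolute value at most 1 and are dropped; one factor |w| is
   then cancelled. *)
have wK : `|w| * `|w| <= `|w| * K.
  rewrite -expr2 -[leLHS]ger0_norm ?exprn_ge0// Ew -mulrA normrM.
  rewrite -[leRHS]mulr1 ler_pM//.
    by rewrite (le_trans (ip_abs_le ipP _ _))// ler_wpM2l.
  rewrite normrM mulr_ile1// ?hitv_norm_le1// (le_trans (ltW ch))//.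
  lra.
have [->|w0] := eqVneq w 0; first by rewrite normr0.
by rewrite -(ler_pM2l (_ : 0 < `|w|))// normr_gt0.
Qed.

End coordinate_taylor.

(** * Measurability and independence *)

Section cube_measurability.
Context (R : realType).

Lemma measurable_hitv_val : measurable_fun setT (@hitv_val R).
Proof. by move=> _ A mA; exists A. Qed.

Lemma measurable_cube_proj j : measurable_fun setT (fun y : cube R => y j).
Proof.
by move=> _ A mA; apply: sub_sigma_algebra; exists j => //; exists A.
Qed.

Lemma measurable_to_cube d (T : measurableType d) (f : T -> cube R) :
  (forall j, measurable_fun setT (fun t => f t j)) -> measurable_fun setT f.
Proof.
move=> mf.
apply: (@measurability _ _ _ _ _ _ (\bigcup_(j in [set: nat])
  preimage_set_system setT (fun y : cube R => y j) measurable)) => //.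
move=> _ [_ [j _ [A mA <-]] <-].
by rewrite !setTI; have := mf j measurableT _ mA; rewrite setTI.
Qed.

Lemma measurable_cube_trunc s : measurable_fun setT (@cube_trunc R s).
Proof.
apply: measurable_to_cube => j; rewrite /cube_trunc.
by case: (j < s)%N; [exact: measurable_cube_proj|exact: measurable_cst].
Qed.

Lemma measurable_cube_map (xi : hitv R -> hitv R) :
  measurable_fun setT xi -> measurable_fun setT (cube_map xi).
Proof.
move=> mxi; apply: measurable_to_cube => j.
by apply: measurableT_comp => //; exact: measurable_cube_proj.
Qed.

(* Round the first [n] coordinates down to a grid of mesh [1 / n.+1] and replace
   the others by [0]. *)
Lemma cube_finite_approx : exists (K : nat -> finType)
    (c : forall n, cube R -> K n) (q : forall n, K n -> cube R),
  (forall n k, measurable (c n @^-1` [set k])) /\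
  (forall z, q n (c n z) @[n --> \oo] --> z).
Proof.
pose a n (z : cube R) i := n.+1%:R * (hitv_val (z i) + 2^-1).
have a0 n z i : 0 <= a n z i.
  apply: mulr_ge0; first exact: ler0n.
  have /andP[? ?] := hitv_valP (z i); lra.
have an n z i : a n z i <= n.+1%:R.
  rewrite ler_piMr//; have /andP[? ?] := hitv_valP (z i); lra.
have ma n i : measurable_fun setT (fun z => a n z i).
  apply: measurable_funM => //; apply: measurable_funD => //.
  apply: measurableT_comp; first exact: measurable_hitv_val.
  exact: measurable_cube_proj.
(* The value [n.+1] does occur, at the right end point 1/2, whence [n.+2] grid values. *)
have tn n z i : (Num.truncn (a n z i) < n.+2)%N.
  by rewrite truncn_lt_nat// (le_lt_trans (an _ _ _))// ltr_nat.
exists (fun n => {ffun 'I_n -> 'I_n.+2}).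
exists (fun n z => [ffun i : 'I_n => Ordinal (tn n z i)]).
exists (fun n (k : {ffun 'I_n -> 'I_n.+2}) (j : nat) => if insub j is Some i then
   clamp ((k i)%:R / n.+1%:R - 2^-1) else hitv0 R).
split=> [n k|z].
  rewrite (_ : _ @^-1` _ = \bigcap_(i in [set: 'I_n])
      [set z | a n z i \in `[(k i)%:R, (k i).+1%:R[ ]).
    apply: fin_bigcap_measurable => // i _.
    have := ma n i measurableT _ (measurable_itv `[(k i)%:R, (k i).+1%:R[).
    by rewrite setTI.
  apply/seteqP; split=> z /=.
    by move=> <- i _ /=; rewrite ffunE in_itv /=; exact: truncn_itv.
  move=> H; apply/ffunP => i; rewrite ffunE; apply/val_inj/eqP => /=.
  rewrite truncn_eq//; have := H i I; by rewrite /= in_itv.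
apply: cube_cvg => j.
rewrite -[z j]clampK.
have cl := @clamp_continuous R (hitv_val (z j)).
have : ((Num.truncn (a n z j))%:R / n.+1%:R - 2^-1 : R) @[n --> \oo]
    --> hitv_val (z j).
  apply/cvgrPdist_le => e e0.
  have := @cvg_harmonic R; move/cvgrPdist_le => /(_ e e0).
  apply: filterS => n /=; rewrite sub0r normrN /harmonic /=.
  rewrite ger0_norm ?invr_ge0//; apply: le_trans.
  have n0 : 0 < n.+1%:R :> R by rewrite ltr0n.
  have /andP[t1 t2] := truncn_itv (a0 n z j).
  rewrite (_ : hitv_val (z j) - _ = (a n z j - (Num.truncn (a n z j))%:R) / n.+1%:R).
    rewrite ger0_norm ?mulr_ge0 ?subr_ge0 ?invr_ge0 ?(ltW n0)//.
    rewrite ler_piMl ?invr_ge0 ?(ltW n0)// lerBlDl ltW//.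
    by rewrite natr1.
  by set m := (Num.truncn _)%:R; rewrite /a; field; rewrite gt_eqF.
move=> /(cvg_comp _ _) /(_ cl); apply: cvg_trans.
(* Coordinate [j] is recorded only once [n] exceeds [j]; earlier approximants have [0] there. *)
apply: near_eq_cvg; exists j.+1 => // n /= jn.
by rewrite insubT /= ffunE.
Qed.

(** Composing [f] with the approximants of [cube_finite_approx] gives functions with finitely many
    values and measurable level sets, which converge everywhere by continuity. The inner [phi]
    stands for [cube_map xi], which is measurable but possibly discontinuous. *)
Lemma continuous_strongly_measurable (X : normedModType R) d
    (T : measurableType d) (P : {measure set T -> \bar R}) (phi : T -> cube R)
    (f : cube R -> X) :
  measurable_fun setT phi -> continuous f -> strongly_measurable P (f \o phi).
Proof.
move=> mphi cf; have [K [c [q [mc qc]]]] := cube_finite_approx.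
exists (fun n t => f (q n (c n (phi t)))); split.
- move=> n; apply: (@sub_finite_set _ _ ((f \o q n) @` [set: K n])).
    by move=> _ [t _ <-]; exists (c n (phi t)).
  exact: finite_image.
- move=> n x; rewrite (_ : _ @^-1` _ = \bigcup_(k in [set k | f (q n k) = x])
     phi @^-1` (c n @^-1` [set k])).
    apply: fin_bigcup_measurable => // k _.
    by have := mphi measurableT _ (mc n k); rewrite setTI.
  apply/seteqP; split=> t /=; first by move=> tx; exists (c n (phi t)).
  by move=> [k /= <- <-].
- apply: aeW => t; exact: (cvg_comp _ _ (qc (phi t)) (cf (phi t))).
Qed.

(** The sigma-algebra is generated by the coordinates, not by the open sets, so continuity does not
    give measurability by definition. The same finite approximations exhibit [f] as a pointwise
    limit of measurable functions. *)
Lemma continuous_cube_measurable (f : cube R -> R) :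
  continuous f -> measurable_fun setT f.
Proof.
move=> cf; have [K [c [q [mc qc]]]] := cube_finite_approx.
apply: (measurable_fun_cvg (h := fun n z => f (q n (c n z)))); last first.
  by move=> z _; exact: (cvg_comp _ _ (qc z) (cf z)).
move=> n _ A mA; rewrite setTI (_ : _ @^-1` _ =
    \bigcup_(k in [set k | A (f (q n k))]) c n @^-1` [set k]).
  exact: fin_bigcup_measurable.
apply/seteqP; split=> z /=; first by move=> tx; exists (c n z).
by move=> [k /= Ak zk]; rewrite zk.
Qed.

End cube_measurability.

(** * Independence of a coordinate from the preceding ones *)

HB.instance Definition _ (R : realType) (n : nat) :=
  isMeasurableFun.Build _ _ _ _ (@cube_trunc R n) (@measurable_cube_trunc R n).

(** The past, padded with zeros, and the next coordinate. The padding keeps every past in the one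
    type [cube R]. *)
Definition trunc_coord (R : realType) (n : nat) (y : cube R) :
  cube R * hitv R := (cube_trunc n y, y n).

Lemma measurable_trunc_coord (R : realType) (n : nat) :
  measurable_fun setT (@trunc_coord R n).
Proof.
by apply: measurable_fun_pair;
  [exact: measurable_cube_trunc|exact: measurable_cube_proj].
Qed.

HB.instance Definition _ (R : realType) (n : nat) :=
  isMeasurableFun.Build _ _ _ _ (@trunc_coord R n) (@measurable_trunc_coord R n).

Lemma bounded_integrable d (T : measurableType d) (R : realType)
    (P : {measure set T -> \bar R}) (f : T -> R) (C : R) :
  (P setT < +oo)%E -> measurable_fun setT f -> (forall t, `|f t| <= C) ->
  P.-integrable setT (EFin \o f).
Proof.
move=> Pfin mf fC; apply: measurable_bounded_integrable => //.
exists C; split; first exact: num_real.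
by move=> M CM t _ /=; rewrite (le_trans (fC t))// ltW.
Qed.

Lemma probability_lty d (T : measurableType d) (R : realType)
    (P : probability T R) : (P setT < +oo)%E.
Proof. by rewrite probability_setT ltry. Qed.

Section coordinate_independence.
Context (R : realType) (mu : probability (hitv R) R) (P : probability (cube R) R).
Hypothesis hP : is_product_measure mu P.

(* Rectangles constraining all coordinates at once, so that stability under
   intersection is immediate. *)
Definition cube_rectangles : set (set (cube R)) :=
  [set B | exists2 A : nat -> set (hitv R), (forall j, measurable (A j)) &
    B = [set y | forall j, A j (y j)]].

Lemma measurable_cube_rectangles : @measurable _ (cube R) = <<s cube_rectangles >>.
Proof.
apply/seteqP; split; last first.
  apply: smallest_sub; first exact: sigma_algebra_measurable.
  move=> _ [A mA ->].
  rewrite (_ : [set _ | _] = \bigcap_j ((fun y : cube R => y j) @^-1` A j)).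
    apply: bigcap_measurable => // j _.
    by have := measurable_cube_proj j measurableT (mA j); rewrite setTI.
  by apply/seteqP; split=> y /= H j; [move=> _; exact: H|exact: (H j I)].
apply: smallest_sub; first exact: smallest_sigma_algebra.
move=> _ [j _ [A mA <-]]; apply: sub_sigma_algebra.
exists (fun i => if i == j then A else setT); first by move=> i; case: ifP.
apply/seteqP; split=> y /=.
  by move=> [_ Ay] i; case: eqVneq => // ->.
by move=> /(_ j); rewrite eqxx.
Qed.

Lemma cube_rectangles_setI : setI_closed cube_rectangles.
Proof.
move=> _ _ [A mA ->] [B mB ->]; exists (fun j => A j `&` B j).
  by move=> j; exact: measurableI.
apply/seteqP; split=> y /=; first by move=> [? ?] j; split.
by move=> H; split=> j; have [] := H j.
Qed.

(** The truncated point is [0] from coordinate [n] on. Either the rectangle excludes [0] at such a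
    coordinate and both sides vanish, or it constrains only the first [n] coordinates and [hP]
    applies with [n] and with [n.+1] factors. *)
Lemma trunc_coord_rectangle n (A : nat -> set (hitv R)) (B : set (hitv R)) :
  (forall j, measurable (A j)) -> measurable B ->
  P (cube_trunc n @^-1` [set y | forall j, A j (y j)] `&` [set y | B (y n)]) =
  (P (cube_trunc n @^-1` [set y | forall j, A j (y j)]) * mu B)%E.
Proof.
move=> mA mB.
have [A0|nA0] := pselect (forall j, (n <= j)%N -> A j (hitv0 R)); last first.
  rewrite (_ : _ @^-1` _ = set0) ?set0I ?measure0 ?mul0e//.
  rewrite -subset0 => y /= H; apply: nA0 => j nj.
  by have := H j; rewrite /cube_trunc ltnNge nj.
pose A' j := if (j < n)%N then A j else B.
have mA' j : measurable (A' j) by rewrite /A'; case: ifP.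
have E : cube_trunc n @^-1` [set y | forall j, A j (y j)] =
    [set y | forall j, (j < n)%N -> A j (y j)].
  apply/seteqP; split=> y /= H j; first by move=> jn;
    have := H j; rewrite /cube_trunc jn.
  by rewrite /cube_trunc; case: ltnP => jn; [exact: H|exact: A0].
rewrite E (_ : _ `&` _ = [set y | forall j, (j < n.+1)%N -> A' j (y j)]).
  rewrite !hP// big_ord_recr /= /A' ltnn; congr (_ * _)%E.
  by apply: eq_bigr => i _; rewrite ltn_ord.
apply/seteqP; split=> y /=.
  move=> [H By] j; rewrite ltnS leq_eqVlt /A' => /orP[/eqP ->|jn].
    by rewrite ltnn.
  by rewrite jn; exact: H.
move=> H; split=> [j jn|]; first by have := H j (ltnW jn); rewrite /A' jn.
by have := H n (ltnSn n); rewrite /A' ltnn.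
Qed.

(** For fixed [B] both sides are finite measures of [A]: the image under truncation of [P]
    restricted to {y_n in B}, and a multiple of the law of the truncation. They agree on the
    rectangles, a generating pi-system. *)
Lemma trunc_coord_independent n (A : set (cube R)) (B : set (hitv R)) :
  measurable A -> measurable B ->
  P (cube_trunc n @^-1` A `&` [set y | B (y n)]) =
  (P (cube_trunc n @^-1` A) * mu B)%E.
Proof.
move=> mA mB.
have mE : measurable [set y : cube R | B (y n)].
  by have := measurable_cube_proj n measurableT mB; rewrite setTI.
have muB : mu B \is a fin_num by exact: fin_num_measure.
pose r : {nonneg R} := NngNum (fine_ge0 (measure_ge0 mu B)).
have -> : (P (cube_trunc n @^-1` A) * mu B)%E =
    mscale r (distribution P (@cube_trunc R n)) A.
  by rewrite /mscale /= fineK// muleC.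
pose m : {measure set (cube R) -> \bar R} :=
  pushforward (mrestr P mE) (@cube_trunc R n).
change (m (measurable_cube_trunc n) A = mscale r (distribution P (@cube_trunc R n)) A).
apply: (@measure_unique _ _ _ cube_rectangles (fun=> setT)) => //.
- exact: measurable_cube_rectangles.
- exact: cube_rectangles_setI.
- by move=> _; exists (fun=> setT) => //; apply/seteqP; split.
- by rewrite bigcup_const.
- move=> _ [C mC ->].
  transitivity (P (cube_trunc n @^-1` [set y | forall j, C j (y j)]) * mu B)%E.
    exact: trunc_coord_rectangle.
  by rewrite muleC -[X in (X * _)%E](fineK muB).
- move=> _; apply: le_lt_trans (ltry 1).
  by apply: (probability_le1 P); rewrite preimage_setT setTI.
Qed.

(** Independence makes the law of [trunc_coord n] a product measure. Fubini then integrates over the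
    last coordinate first, where [h] is constant and [zeta] has mean 0. *)
Lemma integral_coordinate0 n (h : cube R -> R) (zeta : hitv R -> R) (C : R) :
  measurable_fun setT h -> (forall y, `|h y| <= C) ->
  measurable_fun setT zeta -> (forall t, `|zeta t| <= 1) ->
  (\int[mu]_t (zeta t)%:E = 0)%E ->
  (\int[P]_y (h (cube_trunc n y) * zeta (y n))%:E = 0)%E.
Proof.
move=> mh hC mz z1 z0.
pose F (x : cube R * hitv R) := (h x.1 * zeta x.2)%:E.
have FC x : `|h x.1 * zeta x.2| <= C.
  by rewrite normrM -[C]mulr1 ler_pM.
have mF' : measurable_fun [set: cube R * hitv R] (fun x => h x.1 * zeta x.2).
  by apply: measurable_funM; apply: measurableT_comp.
have mF : measurable_fun setT F by apply/measurable_EFinP.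
have -> : (\int[P]_y (h (cube_trunc n y) * zeta (y n))%:E)%E =
    (\int[distribution P (@trunc_coord R n)]_x F x)%E.
  rewrite integral_distribution//.
  apply: (@bounded_integrable _ _ _ _ (fun y => h (cube_trunc n y) * zeta (y n)) C).
  - exact: probability_lty.
  - exact: (measurableT_comp mF' (measurable_trunc_coord n)).
  - by move=> y; exact: (FC (trunc_coord n y)).
rewrite -(@eq_measure_integral _ _ _ _ _ (distribution P (@cube_trunc R n) \x mu)%E);
    last first.
  move=> A mA _; apply: product_measure_unique => // B1 B2 mB1 mB2.
  exact: trunc_coord_independent.
rewrite -integral12_prod_meas1; last first.
  apply: (@bounded_integrable _ _ _ _ (fun x => h x.1 * zeta x.2) C) => //.
  have E := @product_measure1E _ _ _ _ _ (distribution P (@cube_trunc R n)) mu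
    setT setT measurableT measurableT.
  have : ((distribution P (@cube_trunc R n) \x mu)%E (setT `*` setT) < +oo)%E.
    rewrite E lte_mul_pinfty//; last exact: probability_lty.
    exact: (fin_num_measure (distribution P (@cube_trunc R n))).
  by rewrite setXTT.
rewrite integral0_eq// => x _; rewrite /fubini_F /F /=.
under eq_integral do rewrite EFinM.
rewrite integralZl//; first by rewrite z0 mule0.
by apply: (@bounded_integrable _ _ _ _ zeta 1) => //; exact: probability_lty.
Qed.

End coordinate_independence.

(** * The martingale decomposition *)

Section truncation_error.
Context (R : realType) (X : completeNormedModType R) (ip : X -> X -> R).
Hypothesis ipP : inner_product ip.
Context (mu : probability (hitv R) R) (P : probability (cube R) R).
Hypothesis hP : is_product_measure mu P.
Context (xi : hitv R -> hitv R).
Hypothesis xi_meas : measurable_fun setT xi.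
Hypothesis xi0 : xi (hitv0 R) = hitv0 R.
Hypothesis xi_mean : (\int[mu]_t (hitv_val (xi t))%:E = 0)%E.
Context (g : cube R -> X) (b : nat -> R) (K1 K2 : R).
Hypothesis g_diff : contdiff 2 g.
Hypothesis g_bound1 : forall j y, `|partial j g y| <= K1 * b j.
Hypothesis g_bound2 :
  forall j y, `|partial j (partial j g) y| <= K2 * b j ^+ 2.

Definition mart (s n : nat) (z : cube R) : X :=
  \sum_(s <= j < n) hitv_val (z j) *: partial j g (cube_trunc j z).

Definition sqr_tail (s n : nat) : R := \sum_(s <= j < n) b j ^+ 2.

Lemma sqr_tail_ge0 s n : 0 <= sqr_tail s n.
Proof. by apply: sumr_ge0 => j _; exact: sqr_ge0. Qed.

Let g_continuous : continuous g. Proof. by case: g_diff. Qed.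

Let partial_continuous j : continuous (partial j g).
Proof. by case: g_diff => _ /(_ j)[_ []]. Qed.

Let g_trunc_continuous m : continuous (fun z => g (cube_trunc m z)).
Proof.
move=> z.
exact: (cvg_comp _ _ (@cube_trunc_continuous R m z) (@g_continuous _)).
Qed.

Lemma mart_continuous s n : continuous (mart s n).
Proof.
rewrite /mart; elim: (index_iota s n) => [|j r IH].
  rewrite (_ : (fun _ => _) = fun=> 0); first exact: cst_continuous.
  by apply/funext => z; rewrite big_nil.
rewrite (_ : (fun _ => _) = fun z =>
  hitv_val (z j) *: partial j g (cube_trunc j z)
  + \sum_(j <- r) hitv_val (z j) *: partial j g (cube_trunc j z)); last first.
  by apply/funext => z; rewrite big_cons.
move=> z.
have c1 : hitv_val (y j) @[y --> z] --> hitv_val (z j).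
  exact: (cvg_comp _ _ (@cube_proj_continuous R j z) (@hitv_val_continuous R (z j))).
have c2 : partial j g (cube_trunc j y) @[y --> z] --> partial j g (cube_trunc j z).
  exact: (cvg_comp _ _ (@cube_trunc_continuous R j z) (@partial_continuous _ _)).
exact: (cvgD (FF := nbhs_filter z) (cvgZ (FF := nbhs_filter z) c1 c2) (IH z)).
Qed.

(** Only coordinates below [n] enter, so the partial sum belongs to the past of coordinate [n]. *)
Lemma mart_trunc s n z : mart s n (cube_trunc n z) = mart s n z.
Proof.
apply: eq_big_nat => j /andP[_ jn]; rewrite cube_trunc_trunc 1?ltnW//.
by rewrite {1}/cube_trunc jn.
Qed.

Lemma mart_step_le j (z y : cube R) :
  `|hitv_val (z j) *: partial j g y| <= K1 * b j.
Proof.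
rewrite normrZ -[leRHS]mul1r ler_pM//.
exact: hitv_norm_le1.
Qed.

Lemma mart_bounded s n z : `|mart s n z| <= \sum_(s <= j < n) K1 * b j.
Proof.
apply: le_trans (ler_norm_sum _ _ _) _.
by apply: ler_sum => j _; exact: mart_step_le.
Qed.

(** The increment is telescoped over the truncations; [coordinate_taylor], based at
    [cube_trunc j z], bounds the j-th defect by [K2 * b j ^+ 2]. *)
Lemma mart_remainder s n z : (s <= n)%N ->
  `|g (cube_trunc n z) - g (cube_trunc s z) - mart s n z| <= K2 * sqr_tail s n.
Proof.
move=> sn; rewrite -(telescope_sumr (fun k => g (cube_trunc k z)) sn).
rewrite /mart -sumrB; apply: le_trans (ler_norm_sum _ _ _) _.
rewrite /sqr_tail mulr_sumr; apply: ler_sum => j _.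
have := coordinate_taylor ipP (cube_trunc j z) (z j) g_diff (g_bound2 j).
by rewrite -cube_truncS dfwith_trunc0.
Qed.

(** Continuity is used on the cube, before composing with [cube_map xi], which is merely
    measurable. *)
Lemma measurable_sqr_norm (f : cube R -> X) : continuous f ->
  measurable_fun setT (fun y => `|f (cube_map xi y)| ^+ 2).
Proof.
move=> cf; have c : continuous (fun z => `|f z| ^+ 2).
  rewrite (_ : (fun _ => _) = fun z => ip (f z) (f z)).
    exact: (ip_continuous ipP).
  by apply/funext => z; rewrite (ipE ipP).
exact: (measurableT_comp (continuous_cube_measurable c) (measurable_cube_map xi_meas)).
Qed.

(** Induction on the number of summands: expanding the square of the enlarged sum gives a cross term
    of integral 0 and a diagonal term at most (K1 b_N)^2. *)
Lemma mart_second_moment s n : (s <= n)%N ->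
  (\int[P]_y (`|mart s n (cube_map xi y)| ^+ 2)%:E
     <= (K1 ^+ 2 * sqr_tail s n)%:E)%E.
Proof.
move=> sn; rewrite -(subnKC sn); elim: (n - s)%N => [|m].
  rewrite addn0 /sqr_tail big_geq// mulr0 integral0_eq// => y _.
  by rewrite /mart big_geq// normr0 expr0n.
set N := (s + m)%N => IH; rewrite addnS -/N.
have sN : (s <= N)%N by rewrite leq_addr.
pose h z := ip (mart s N z) (partial N g z).
have hcont : continuous h.
  by apply: (ip_continuous ipP); [exact: mart_continuous|exact: partial_continuous].
set B := \sum_(s <= j < N) K1 * b j.
pose H y := h (cube_map xi y).
have mH : measurable_fun setT H.
  exact: (measurableT_comp (continuous_cube_measurable hcont) (measurable_cube_map xi_meas)).
have HB y : `|H y| <= B * (K1 * b N).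
  rewrite (le_trans (ip_abs_le ipP _ _))// ler_pM//.
  exact: mart_bounded.
have mz : measurable_fun setT (fun t => hitv_val (xi t)).
  exact: (measurableT_comp (@measurable_hitv_val R) xi_meas).
have cross0 :=
  integral_coordinate0 hP N mH HB mz (fun t => hitv_norm_le1 (xi t)) xi_mean.
pose u y := `|mart s N (cube_map xi y)| ^+ 2.
(* [H] is taken at the truncated point because the new summand of [mart] differentiates [g] at
   [cube_trunc N]; the factor [mart s N] is unchanged there by [mart_trunc]. *)
pose v y := 2 * (H (cube_trunc N y) * hitv_val (xi (y N))).
have mu' : measurable_fun setT u := measurable_sqr_norm (@mart_continuous s N).
have mcross : measurable_fun setT (fun y => H (cube_trunc N y) * hitv_val (xi (y N))).
  apply: measurable_funM.
    exact: (measurableT_comp mH (@measurable_cube_trunc R N)).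
  exact: (measurableT_comp mz (@measurable_cube_proj R N)).
(* The cross term has no sign, so splitting the integral below rests on integrability, obtained from
   boundedness. *)
have iu : P.-integrable setT (EFin \o u).
  apply: (bounded_integrable (C := B ^+ 2)) => // [|y]; first exact: probability_lty.
  rewrite ger0_norm ?exprn_ge0// lerXn2r ?nnegrE ?mart_bounded//.
  exact: le_trans (mart_bounded s N y).
have ic : P.-integrable setT (EFin \o
    (fun y => H (cube_trunc N y) * hitv_val (xi (y N)))).
  apply: (bounded_integrable (C := B * (K1 * b N))) => // [|y].
    exact: probability_lty.
  by rewrite normrM -[leRHS]mulr1 ler_pM// hitv_norm_le1.
pose w y := u y + v y.
have mv : measurable_fun setT v by exact: measurable_funM.
have uvE y : `|mart s N.+1 (cube_map xi y)| ^+ 2 <= w y + (K1 * b N) ^+ 2.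
  rewrite /mart big_nat_recr//= -/(mart s N _) (sqr_normD ipP) /w /u /v /H /h.
  rewrite cube_map_trunc// mart_trunc (ipZr ipP) [X in 2 * X]mulrC lerD2l.
  by rewrite lerXn2r ?nnegrE ?mart_step_le//
    (le_trans _ (mart_step_le N (cube_map xi y) y)).
apply: (@le_trans _ _ (\int[P]_y (w y + (K1 * b N) ^+ 2)%:E)%E).
  apply: ge0_le_integral => //.
  - by apply/measurable_EFinP; exact: (measurable_sqr_norm (@mart_continuous s _)).
  - by apply/measurable_EFinP; apply: measurable_funD => //; exact: measurable_funD.
  - by move=> y _; rewrite lee_fin.
have iv : P.-integrable setT (EFin \o v).
  rewrite (_ : _ \o _ = fun y => (2%:E * (H (cube_trunc N y) * hitv_val (xi (y N)))%:E)%E).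
    exact: integrableZl.
  by apply/funext => y; rewrite /= /v EFinM.
have -> : (\int[P]_y (w y + (K1 * b N) ^+ 2)%:E =
    \int[P]_y (u y)%:E + \int[P]_y (v y)%:E + ((K1 * b N) ^+ 2)%:E)%E.
  under eq_integral do rewrite EFinD.
  rewrite integralD//; first last.
  - by apply: finite_measure_integrable_cst.
  - exact: (integrableD measurableT iu iv).
  rewrite integral_cst//; congr (_ + _)%E.
    by rewrite -(integralD measurableT iu iv).
  by rewrite -[RHS]mule1; congr (_ * _)%E; exact: probability_setT.
have -> : (\int[P]_y (v y)%:E = 0)%E.
  rewrite /v; under eq_integral do rewrite EFinM.
  by rewrite integralZl// cross0 mule0.
rewrite adde0 /sqr_tail big_nat_recr//= -/(sqr_tail s N) mulrDr EFinD -exprMn.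
exact: leeD2r.
Qed.


(** The squared norm of martingale plus remainder is at most twice the sum of the squares. Bounding
    the tail by [tau] makes the right-hand side independent of [n], ready for Fatou's lemma. *)
Lemma truncation_second_moment s n tau : (s <= n)%N -> sqr_tail s n <= tau ->
  (\int[P]_y (`|g (cube_trunc n (cube_map xi y))
               - g (cube_trunc s (cube_map xi y))| ^+ 2)%:E
     <= (2 * K1 ^+ 2 * tau + 2 * (K2 * tau) ^+ 2)%:E)%E.
Proof.
move=> sn stau; set D := fun z => g (cube_trunc n z) - g (cube_trunc s z).
have cD : continuous D.
  by move=> z; exact: (cvgB (FF := nbhs_filter z)
    (@g_trunc_continuous n z) (@g_trunc_continuous s z)).
(* The sign of [K2] is unknown in this section, so enlarging the tail to [tau] calls for its
   absolute value, which disappears on squaring. *)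
have K2tau z : `|D z - mart s n z| <= `|K2| * tau.
  apply: le_trans (mart_remainder z sn) _.
  apply: (@le_trans _ _ (`|K2| * sqr_tail s n)); last exact: ler_wpM2l.
  by apply: ler_wpM2r; [exact: sqr_tail_ge0|exact: ler_norm].
pose u y := 2 * `|mart s n (cube_map xi y)| ^+ 2.
have mu' : measurable_fun setT u.
  by apply: measurable_funM => //; exact: (measurable_sqr_norm (@mart_continuous s n)).
have u0 y : (0 <= (u y)%:E)%E by rewrite lee_fin mulr_ge0.
pose c := 2 * (K2 * tau) ^+ 2.
have c0 : 0 <= c by rewrite mulr_ge0 ?sqr_ge0.
have Duc y : `|D (cube_map xi y)| ^+ 2 <= u y + c.
  set z := cube_map xi y; rewrite -[D z](subrK (mart s n z)).
  apply: (@le_trans _ _ ((`|D z - mart s n z| + `|mart s n z|) ^+ 2)).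
    by rewrite lerXn2r ?nnegrE ?addr_ge0 ?ler_normD.
  apply: (@le_trans _ _ (2 * `|mart s n z| ^+ 2 + 2 * `|D z - mart s n z| ^+ 2)).
    by rewrite -subr_ge0; have := sqr_ge0 (`|D z - mart s n z| - `|mart s n z|); nra.
  rewrite /u /c lerD2l ler_wpM2l// -(real_normK (num_real (K2 * tau))) lerXn2r ?nnegrE//.
  apply: le_trans (K2tau z) _; rewrite normrM ler_wpM2l//.
  exact: ler_norm.
apply: (@le_trans _ _ (\int[P]_y (u y + c)%:E)%E).
  apply: ge0_le_integral => //.
  - by apply/measurable_EFinP; exact: (measurable_sqr_norm cD).
  - by apply/measurable_EFinP; exact: measurable_funD.
  - by move=> y _; rewrite lee_fin; exact: Duc.
under eq_integral do rewrite EFinD.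
rewrite ge0_integralD//; last exact/measurable_EFinP.
rewrite integral_cst// EFinD; apply: leeD; last first.
  by rewrite -[leRHS]mule1; apply: lee_pmul => //; exact: probability_le1.
rewrite /u; under eq_integral do rewrite EFinM.
rewrite ge0_integralZl_EFin//; last first.
  by apply/measurable_EFinP; exact: (measurable_sqr_norm (@mart_continuous s _)).
rewrite -mulrA EFinM lee_wpmul2l//.
apply: le_trans (mart_second_moment sn) _.
by rewrite lee_fin ler_wpM2l ?sqr_ge0.
Qed.

Lemma error_second_moment s tau : (forall n, (s <= n)%N -> sqr_tail s n <= tau) ->
  (\int[P]_y (`|g (cube_map xi y) - g (cube_trunc s (cube_map xi y))| ^+ 2)%:E
     <= (2 * K1 ^+ 2 * tau + 2 * (K2 * tau) ^+ 2)%:E)%E.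
Proof.
(* The shift by [s] makes every index admissible, as [s <= n + s]. *)
move=> stau; pose D n z := g (cube_trunc (n + s) z) - g (cube_trunc s z).
have cD n : continuous (D n).
  by move=> z; exact: (cvgB (FF := nbhs_filter z)
    (@g_trunc_continuous _ z) (@g_trunc_continuous s z)).
pose f n y := (`|D n (cube_map xi y)| ^+ 2)%:E.
have mf n : measurable_fun setT (f n).
  by apply/measurable_EFinP; exact: (measurable_sqr_norm (cD n)).
have limf y : limn_einf (f^~ y) =
    (`|g (cube_map xi y) - g (cube_trunc s (cube_map xi y))| ^+ 2)%:E.
  set z := cube_map xi y; apply: (cvg_limn_einf_sup _).1.
  apply: cvg_EFin; first by apply: nearW.
  have c1 : D n z @[n --> \oo] --> g z - g (cube_trunc s z).
    apply: cvgB; last exact: cvg_cst.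
    have c2 : cube_trunc (n + s) z @[n --> \oo] --> z.
      by rewrite (cvg_shiftn s (fun n => cube_trunc n z)); exact: cube_trunc_cvg.
    exact: (cvg_comp _ _ c2 (@g_continuous z)).
  have c3 : `|D n z| @[n --> \oo] --> `|g z - g (cube_trunc s z)|.
    exact: cvg_norm.
  have c4 : `|D n z| * `|D n z| @[n --> \oo] -->
      `|g z - g (cube_trunc s z)| * `|g z - g (cube_trunc s z)|.
    exact: cvgM.
  exact: c4.
have f0 n y : [set: cube R] y -> (0 <= f n y)%E by move=> _; rewrite lee_fin.
have := fatou P measurableT mf f0.
under eq_integral do rewrite limf.
(* The lower limit is the limit of the tail infima of the integrals, each at most the integral of
   the same index. *)
move/le_trans; apply; rewrite limn_einf_lim; apply: lime_le.
  exact: is_cvg_einfs.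
near=> n.
apply: le_trans (truncation_second_moment (leq_addl n s) (stau _ (leq_addl n s))).
by apply: ereal_inf_lbound; exists n => /=.
Unshelve. all: by end_near. Qed.


End truncation_error.

(** * The constants *)

Lemma sqr_tail_le (R : realType) (b : nat -> R) (p : R) : 0 < p < 1 ->
  (forall j, 0 <= b j) -> nonincreasing_seq b ->
  (\sum_(0 <= j <oo) (b j `^ p)%:E < +oo)%E ->
  exists2 A, 0 <= A & forall s n, (1 <= s)%N ->
    sqr_tail b s n <= A * s%:R `^ (1 - 2 / p).
Proof.
move=> /andP[p0 p1] b0 bn bp.
have tfin : (\sum_(0 <= j <oo) (b j `^ p)%:E \is a fin_num)%E.
  by rewrite ge0_fin_numE// nneseries_ge0// => n _ _; rewrite lee_fin powR_ge0.
pose S := fine (\sum_(0 <= j <oo) (b j `^ p)%:E)%E.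
have S0 : 0 <= S.
  by apply/fine_ge0/nneseries_ge0 => n _ _; rewrite lee_fin powR_ge0.
have SE n : \sum_(0 <= j < n) b j `^ p <= S.
  rewrite -lee_fin fineK// -sumEFin; apply: nneseries_lim_ge => j _ _.
  by rewrite lee_fin powR_ge0.
(* The exponent [e] satisfies p e = 2 - p and -e = 1 - 2/p: it turns a bound on b_s^p by S/s into
   one on b_s^(2-p) with the rate of the claim. *)
pose e := (2 - p) / p.
have e0 : 0 <= e by rewrite divr_ge0; lra.
exists (S `^ e * S); first by rewrite mulr_ge0 ?powR_ge0.
move=> s n s1; have s0 : 0 < s%:R :> R by rewrite ltr0n.
(* Numbering from 0 leaves exactly [s] indices below [s], and by monotonicity each of their terms is
   at least b_s^p. *)
have bs : b s `^ p <= S / s%:R.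
  rewrite ler_pdivlMr// mulr_natr; apply: le_trans (SE s).
  rewrite -[s in _ *+ s]subn0 -sumr_const_nat; apply: ler_sum_nat => j /andP[_ js].
  by apply: ge0_ler_powR; rewrite ?nnegrE ?(ltW p0)//; exact/bn/ltnW.
have bse : b s `^ (2 - p) <= S `^ e * s%:R `^ (1 - 2 / p).
  rewrite (_ : 2 - p = p * e); last by rewrite /e mulrC divfK ?gt_eqF.
  rewrite (powRrM _ p e) (_ : 1 - 2 / p = (-1) * e); last first.
    by rewrite /e; field; rewrite gt_eqF.
  rewrite (powRrM _ (-1) e) powR_inv1 ?(ltW s0)// -powRM ?invr_ge0 ?(ltW s0)//.
  by apply: (ge0_ler_powR e0); rewrite ?nnegrE ?powR_ge0 ?divr_ge0 ?(ltW s0)//.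
rewrite mulrAC; apply: (@le_trans _ _ (b s `^ (2 - p) * S)); last exact: ler_wpM2r.
have [ns|sn] := leqP n s.
  by rewrite /sqr_tail big_geq// mulr_ge0 ?powR_ge0.
apply: (@le_trans _ _ (b s `^ (2 - p) * \sum_(s <= j < n) b j `^ p)); last first.
  rewrite ler_wpM2l ?powR_ge0//; apply: le_trans (SE n).
  rewrite [leRHS](big_cat_nat (n := s))//= ?(ltnW sn)// lerDr.
  by apply: sumr_ge0 => j _; exact: powR_ge0.
rewrite /sqr_tail mulr_sumr; apply: ler_sum_nat => j /andP[sj _].
(* The square splits as b_j^(2-p) b_j^p. The exponents add up to 2, which is nonzero, so the
   addition law also covers [b j = 0]. *)
rewrite -powR_mulrn// -[X in _ `^ X](subrK p) powRD; last first.
  by rewrite subrK pnatr_eq0.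
rewrite ler_wpM2r ?powR_ge0//; apply: ge0_ler_powR; rewrite ?nnegrE//; first lra.
exact: bn.
Qed.

(** * Multi-indices supported at one coordinate *)

Definition single_index (j m : nat) : multi_index :=
  [fsfun i in [fset j]%fset => m | 0%N]%fset.

Lemma finsupp_single_index j m : (0 < m)%N ->
  finsupp (single_index j m) = [fset j]%fset.
Proof.
move=> m0; apply/fsetP => i; rewrite mem_finsupp fsfunE !inE.
by case: ifP => _; [rewrite -lt0n m0|rewrite eqxx].
Qed.

Lemma single_indexE j m : single_index j m j = m.
Proof. by rewrite fsfunE !inE eqxx. Qed.

Lemma mi_abs_single j m : (0 < m)%N -> mi_abs (single_index j m) = m.
Proof.
by move=> m0; rewrite /mi_abs finsupp_single_index// big_seq_fset1 single_indexE.
Qed.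

Lemma mi_pow_single (R : realType) (b : nat -> R) j m : (0 < m)%N ->
  mi_pow b (single_index j m) = b j ^+ m.
Proof.
by move=> m0; rewrite /mi_pow finsupp_single_index// big_seq_fset1 single_indexE.
Qed.

(** With [0 < m] the support is exactly {j}, so the fold has a single step. The cases [m = 1] and
    [m = 2] turn the bound on mixed derivatives into the two bounds of the martingale argument. *)
Lemma mixed_partial_single (R : realType) (X : normedModType R)
    (g : cube R -> X) j m : (0 < m)%N ->
  mixed_partial (single_index j m) g = iter m (partial j) g.
Proof.
move=> m0; rewrite /mixed_partial finsupp_single_index//.
have -> : ([fset j]%fset : seq nat) = [:: j].
  by apply: perm_small_eq => //; apply: (uniq_perm (fset_uniq _)) => // i; rewrite !inE.
by rewrite /= single_indexE.
Qed.

Lemma contdiff_le (R : realType) (X : normedModType R) m n (f : cube R -> X) :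
  (m <= n)%N -> contdiff n f -> contdiff m f.
Proof.
elim: m n f => [|m IH] [|n] f //; first by move=> _ [].
move=> mn [cf df]; split=> // j; have [pd cd] := df j.
by split=> //; exact: IH cd.
Qed.

(** * Choice of the constant and the rate in [s] *)

Theorem corollary1 (R : realType) (X : completeNormedModType R)
  (hX : is_hilbert X) (sepX : separable X)
  (mu : probability (hitv R) R)
  (P : probability (cube R) R) (hP : is_product_measure mu P)
  (p : R) (hp : 0 < p < 1)
  (k : nat) (hk : k%:Z = Num.ceil (1 / (1 - p)))
  (g : cube R -> X)
  (h1 : {ae P, forall y : cube R,
           `|g y - g (cube_trunc s y)| @[s --> \oo] --> (0 : R)})
  (Theta : nat -> R) (Theta_ge0 : forall l, 0 <= Theta l)
  (b : nat -> R) (b_ge0 : forall j, 0 <= b j)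
  (b_lp : (\sum_(0 <= j <oo) (b j `^ p)%:E < +oo)%E)
  (b_noninc : nonincreasing_seq b)
  (g_diff : contdiff k.+1 g)
  (g_bound : forall (nu : multi_index) (y : cube R), (mi_abs nu <= k.+1)%N ->
     `|mixed_partial nu g y| <= Theta (mi_abs nu) * mi_pow b nu)
  (mu_mean : (\int[mu]_y (hitv_val y)%:E = 0)%E)
  (Cmu : R) (Cmu_ge0 : 0 <= Cmu)
  (mu_moments : forall m : nat, (2 <= m)%N ->
     (\int[mu]_y (`|hitv_val y| ^+ m)%:E <= Cmu%:E)%E)
  (xi : hitv R -> hitv R) (xi_meas : measurable_fun setT xi)
  (xi0 : xi (hitv0 R) = hitv0 R)
  (xi_mean : (\int[mu]_y (hitv_val (xi y))%:E = 0)%E)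
  (Cxi : R) (Cxi_ge0 : 0 <= Cxi)
  (xi_moments : forall m : nat, (2 <= m)%N ->
     (\int[mu]_y (`|hitv_val (xi y)| ^+ m)%:E <= Cxi%:E)%E) :
  let gxi := fun y : cube R => g (cube_map xi y) in
  let gxis := fun (s : nat) (y : cube R) => gxi (cube_trunc s y) in
  exists C : R, 0 < C /\
    forall s : nat, (1 <= s)%N ->
      strongly_measurable P (fun y => gxi y - gxis s y) /\
      (L2norm P (fun y => gxi y - gxis s y)%R
         <= (C * s%:R `^ (- (1 / p) + 1 / 2))%R%:E)%E.
Proof.
have [ip ipP] := hilbert_inner_product hX.
have /andP[p0 p1] := hp.
(* As [1 / (1 - p)] is positive, its ceiling is at least 1, and order [k.+1] includes the second
   derivatives. *)
have k1 : (1 <= k)%N.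
  by rewrite -ltz_nat hk ceil_gt0 divr_gt0// subr_gt0.
have g_diff2 : contdiff 2 g by exact: contdiff_le g_diff.
have g_bound1 j y : `|partial j g y| <= Theta 1%N * b j.
  have := g_bound (single_index j 1) y.
  by rewrite mixed_partial_single// mi_abs_single// mi_pow_single// expr1; exact.
have g_bound2 j y : `|partial j (partial j g) y| <= Theta 2%N * b j ^+ 2.
  have := g_bound (single_index j 2) y.
  by rewrite mixed_partial_single// mi_abs_single// mi_pow_single//; exact.
have [A A0 Atail] := sqr_tail_le hp b_ge0 b_noninc b_lp.
move=> gxi gxis; have gxisE s y :
    gxi y - gxis s y = g (cube_map xi y) - g (cube_trunc s (cube_map xi y)).
  by rewrite /gxis /gxi cube_map_trunc.
have cg : continuous g by case: g_diff.
(* This is the bound of [error_second_moment] at [tau = A]. The 1 added to its square root below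
   keeps the constant positive when [D = 0]. *)
pose D := 2 * Theta 1%N ^+ 2 * A + 2 * (Theta 2%N * A) ^+ 2.
have D0 : 0 <= D by rewrite addr_ge0 ?mulr_ge0 ?sqr_ge0.
exists (Num.sqrt D + 1); split; first by rewrite ltr_wpDl ?sqrtr_ge0.
move=> s s1.
have s0 : 1 <= s%:R :> R by rewrite ler1n.
split.
  rewrite (_ : (fun _ => _) =
    (fun z => g z - g (cube_trunc s z)) \o cube_map xi); last first.
    by apply/funext => y; rewrite gxisE.
  apply: continuous_strongly_measurable; first exact: measurable_cube_map.
  move=> z; have c1 := cvg_comp _ _ (@cube_trunc_continuous R s z) (cg _).
  exact: (cvgB (FF := nbhs_filter z) (cg z) c1).
set r := s%:R `^ (1 - 2 / p).
have r0 : 0 <= r by exact: powR_ge0.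
(* The exponent is negative and [s] is at least 1. Hence r^2 <= r, which absorbs the quadratic
   remainder term into [D * r]. *)
have r1 : r <= 1.
  rewrite /r -[leRHS](powRr0 s%:R); apply: ler_powR => //.
  by rewrite subr_le0 ler_pdivlMr// mul1r; lra.
have tail n : (s <= n)%N -> sqr_tail b s n <= A * r by move=> _; exact: Atail.
have := error_second_moment ipP hP xi_meas xi0 xi_mean g_diff2 g_bound1 g_bound2 tail.
move=> I2.
have I2D : (\int[P]_y (`|gxi y - gxis s y| ^+ 2)%:E <= (D * r)%:E)%E.
  under eq_integral do rewrite gxisE.
  apply: le_trans I2 _; rewrite lee_fin -subr_ge0.
  rewrite (_ : _ - _ = 2 * (Theta 2%N * A) ^+ 2 * r * (1 - r)); last first.
    by rewrite /D; ring.
  by rewrite !mulr_ge0 ?sqr_ge0// subr_ge0.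
rewrite /L2norm unlock.
under eq_integral do rewrite abse_EFin normr_id poweR_EFin powR_mulrn//.
(* Halving the exponent [1 - 2 / p] of the squared norm gives [- (1 / p) + 1 / 2]. *)
have sr : (Num.sqrt D + 1) * s%:R `^ (- (1 / p) + 1 / 2) =
    (Num.sqrt D + 1) * Num.sqrt r.
  congr (_ * _); rewrite -powR12_sqrt// /r -powRrM; congr (_ `^ _).
  by field; rewrite gt_eqF.
rewrite sr.
apply: (@le_trans _ _ (((D * r)%:E) `^ 2^-1)%E).
  apply: gt0_ler_poweR => //; rewrite ?in_itv /= ?leey ?andbT.
  - by apply: integral_ge0 => y _; rewrite lee_fin.
  - by rewrite lee_fin mulr_ge0.
rewrite poweR_EFin lee_fin powR12_sqrt ?mulr_ge0// sqrtrM// ler_wpM2r ?sqrtr_ge0//.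
by rewrite lerDl.
Qed.
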